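(* $\mathrm{add}(f\mathcal{N}(\mathrm{Fin}))\geq\mathfrak{b}$.
   Context: $\exists^\infty n$ means ''for infinitely many $n\in\omega$''. A subset $F\subseteq\omega^\omega$ belongs to $f\mathcal{N}(\mathrm{Fin})$ if there is a sequence $(S_n)_{n\in\omega}$ of finite sets $S_n\subseteq\omega^n$ such that $F\subseteq\{x\in\omega^\omega:(\exists^\infty n)(x\upharpoonright n\in S_n)\}$; this is a $\sigma$-ideal. For a $\sigma$-ideal $\mathcal{I}$, $\mathrm{add}(\mathcal{I})=\min\{|\mathcal{A}|:\mathcal{A}\subseteq\mathcal{I}\wedge\bigcup\mathcal{A}\notin\mathcal{I}\}$. $\mathfrak{b}=\min\{|\mathcal{F}|:\mathcal{F}\subseteq\omega^\omega\wedge(\forall x\in\omega^\omega)(\exists f\in\mathcal{F})(\exists^\infty n)(x(n)<f(n))\}$. *)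

(* Defs.v *)
From mathcomp Require Import all_boot.
From mathcomp Require Import boolp classical_sets functions cardinality.

Set Implicit Arguments.
Unset Strict Implicit.
Unset Printing Implicit Defensive.

Local Open Scope classical_set_scope.
Local Open Scope card_scope.

(* A cardinal number is represented by a set of that cardinality, and cardinals
   are compared with [#<=].  [min_card P] represents min {|A| : A in P}; it is
   meaningful only when [P] is nonempty. *)
Definition min_card (T : pointedType) (P : set (set T)) : set T :=
  [get A : set T | P A /\ forall B : set T, P B -> A #<= B].

Lemma min_cardP (T : pointedType) (P : set (set T)) :
  P !=set0 -> P (min_card P) /\ forall B : set T, P B -> min_card P #<= B.
Proof.
move=> [A0 PA0]; apply: (@getPex _ [set A | P A /\ forall B, P B -> A #<= B]).
(* [M] is a maximal set of choice functions for [P], pairwise distinct at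
   every member of [P]. *)
pose Q : set (set (set T -> T)) := [set M |
  (forall f B, M f -> P B -> B (f B)) /\
  (forall f g B, M f -> M g -> P B -> f B = g B -> f = g)].
have [|M [[Mch Minj] Mmax]] := @Zorn_bigcup _ Q.
  move=> F FQ Ftot; split=> [f B [X FX Xf] PB|f g B [X FX Xf] [Y FY Yg] PB fg].
    by have [ch _] := FQ X FX; exact: ch Xf PB.
  case: (Ftot X Y FX FY) => sub.
    by have [_ inj] := FQ Y FY; exact: inj (sub _ Xf) Yg PB fg.
  by have [_ inj] := FQ X FX; exact: inj Xf (sub _ Yg) PB fg.
have [B [PB BM]] : exists B, P B /\ B `<=` (fun f => f B) @` M.
  apply: contrapT => noB.
  have wit B : exists b, P B -> B b /\ ~ ((fun f => f B) @` M) b.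
    have [PB|nPB] := pselect (P B); last by exists point => /nPB.
    apply: contrapT => nb; apply: noB; exists B; split=> // b Bb.
    by apply: contrapT => nMb; apply: nb; exists b.
  have [h hP] := choice wit.
  have Mh f B : M f -> P B -> f B <> h B.
    by move=> Mf PB e; apply: (hP B PB).2; exists f.
  apply: (Mmax (M `|` [set h]) _ _).
    split; first by move=> f Mf; left.
    by move=> /(_ h (or_intror erefl)) hM; apply: (Mh h A0 hM PA0).
  split=> [f B [Mf|->] PB|f g B [Mf|->] [Mg|->] PB e].
  - exact: Mch Mf PB.
  - exact: (hP B PB).1.
  - exact: Minj Mf Mg PB e.
  - by case: (Mh f B Mf PB e).
  - by case: (Mh g B Mg PB (esym e)).
  - by [].
exists B; split=> // C PC.
apply: (card_le_trans (subset_card_le BM)).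
apply: (card_le_trans (card_image_le _ _)).
have /card_eqPle[_ MC] : (fun f => f C) @` M #= M.
  by apply: inj_card_eq => f g /set_mem Mf /set_mem Mg; apply: Minj.
apply: (card_le_trans MC); apply: subset_card_le => _ [f Mf <-].
exact: Mch Mf PC.
Qed.

Definition add (X : Type) (I : set (set X)) : set (set X) :=
  min_card [set A : set (set X) | A `<=` I /\ ~ I (\bigcup_(F in A) F)].

Definition exists_infinitely_many (p : nat -> Prop) : Prop :=
  infinite_set [set n | p n].

Definition b_number : set (nat -> nat) :=
  min_card [set F : set (nat -> nat) |
    forall x : nat -> nat, exists2 f, F f &
      exists_infinitely_many (fun n => x n < f n)].

Definition restr (x : nat -> nat) (n : nat) : n.-tuple nat := [tuple x i | i < n].

Definition fN_Fin : set (set (nat -> nat)) :=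
  [set F : set (nat -> nat) | exists S : forall n, set (n.-tuple nat),
    (forall n, finite_set (S n)) /\
    F `<=` [set x | exists_infinitely_many (fun n => S n (restr x n))]].

(* Main.v *)
Require Import Defs.
From mathcomp Require Import all_boot.
From mathcomp Require Import boolp classical_sets functions cardinality.

Set Implicit Arguments.
Unset Strict Implicit.
Unset Printing Implicit Defensive.

Local Open Scope classical_set_scope.
Local Open Scope card_scope.

(** A finite set of words of length [n] lies in some box, the set of words with
    all entries at most a constant.  Hence a set [F] of the ideal is witnessed,
    after enlarging the finite sets, by boxes with bounds [g n]: [F] is
    contained in the set [box_limsup g] of the [x] whose restriction to [n] is
    in the [n]-th box for infinitely many [n] ([fN_Fin_box_limsup],
    [box_limsup_fN_Fin]).  So the ideal is governed by single functions [g], and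
    [box_limsup g] only grows when [g] is replaced by a function that eventually
    dominates it ([box_limsup_le]).

    Let now a family of members of the ideal have a union outside of it, and
    choose a bounding function for each member.  If one function [x] eventually
    dominated all of them, the union would be contained in [box_limsup x], a
    member of the ideal.  So these functions form an unbounded family, and there
    are at most as many of them as members of the family
    ([unbounded_image_of_fN_Fin_family]); this is the inequality.  The
    minimum defining the additivity is attained because the ideal contains the
    singletons and is proper: diagonalising against the bounds [g] shows that no
    [box_limsup g] is everything ([fN_Fin_proper]). *)

Definition box (g : nat -> nat) (n : nat) : set (n.-tuple nat) :=
  [set s | forall i, tnth s i <= g n].

Arguments box : clear implicits.

Definition box_limsup (g : nat -> nat) : set (nat -> nat) :=
  [set x | exists_infinitely_many (fun n => box g n (restr x n))].

Definition unbounded (B : set (nat -> nat)) : Prop :=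
  forall x : nat -> nat, exists2 f, B f &
    exists_infinitely_many (fun n => x n < f n).

Lemma finite_box (g : nat -> nat) (n : nat) : finite_set (box g n).
Proof.
pose f (t : n.-tuple 'I_(g n).+1) : n.-tuple nat := map_tuple val t.
apply: (@sub_finite_set _ _ (range f)); last first.
  by apply: finite_image; exact: finite_finset.
move=> s sg; exists [tuple inord (tnth s i) | i < n] => //.
by apply: eq_from_tnth => i; rewrite tnth_map tnth_mktuple /= inordK // ltnS.
Qed.

Lemma finite_sub_box (n : nat) (S : set (n.-tuple nat)) :
  finite_set S -> exists m, forall s, S s -> forall i, tnth s i <= m.
Proof.
case/finite_seqP => l ->; exists (\max_(s <- l) \max_(i < n) tnth s i).
move=> s sl i; apply: leq_trans (leq_bigmax i) _.
exact: (leq_bigmax_seq (F := fun s : n.-tuple nat => \max_(i < n) tnth s i)).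
Qed.

Lemma box_limsup_fN_Fin (g : nat -> nat) : fN_Fin (box_limsup g).
Proof. by exists (box g); split=> // n; exact: finite_box. Qed.

Lemma fN_Fin_box_limsup (F : set (nat -> nat)) :
  fN_Fin F -> exists g, F `<=` box_limsup g.
Proof.
move=> [S [Sfin FS]].
have [g Sg] := choice (fun n => finite_sub_box (Sfin n)).
exists g => x /FS; apply: contra_not; apply: sub_finite_set => n /=.
exact: Sg.
Qed.

(** Eventual domination makes the set of indices where the box of [g] exceeds
    that of [h] finite, and removing finitely many indices keeps the remaining
    set infinite. *)
Lemma box_limsup_le (g h : nat -> nat) :
  finite_set [set n | h n < g n] -> box_limsup g `<=` box_limsup h.
Proof.
move=> hg x; apply: contra_not => xh.
suff: finite_set ([set n | box h n (restr x n)] `|` [set n | h n < g n]).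
  apply: sub_finite_set => n xg; have [gh|] := leqP (g n) (h n); last by right.
  by left=> i; apply: leq_trans (xg i) gh.
by rewrite finite_setU.
Qed.

Lemma fN_Fin_set1 (x : nat -> nat) : fN_Fin [set x].
Proof.
exists (fun n => [set restr x n]); split=> [n|_ ->]; first exact: finite_set1.
rewrite /= /exists_infinitely_many [X in infinite_set X](_ : _ = setT).
  exact: infinite_nat.
by apply/seteqP; split.
Qed.

(** The last entry of a restriction to [n.+1] is its value at [n], so a point
    with value above [g n.+1] at every [n] avoids all boxes of positive
    length. *)
Lemma fN_Fin_proper : ~ fN_Fin setT.
Proof.
move=> /fN_Fin_box_limsup[g /(_ (fun n => (g n.+1).+1) I)]; apply.
apply: (@sub_finite_set _ _ [set 0]); last exact: finite_set1.
by move=> [//|n] /= /(_ ord_max); rewrite tnth_mktuple ltnn.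
Qed.

(** The image is taken under a choice of bounding functions; a function that
    eventually dominates the image would put the whole union into the ideal. *)
Lemma unbounded_image_of_fN_Fin_family (A : set (set (nat -> nat))) :
  A `<=` fN_Fin -> ~ fN_Fin (\bigcup_(F in A) F) ->
  exists G : set (nat -> nat) -> nat -> nat, unbounded (G @` A).
Proof.
move=> AI AnI.
have wit F : exists g, A F -> F `<=` box_limsup g.
  have [/AI/fN_Fin_box_limsup[g Fg]|nAF] := pselect (A F); first by exists g.
  by exists point => /nAF.
have [G FG] := choice wit; exists G => x.
apply: contrapT => xdom; apply: AnI.
have [S [Sfin xS]] := box_limsup_fN_Fin x.
exists S; split=> // y [F AF Fy]; apply/xS/box_limsup_le/(FG F AF _ Fy).
apply: contrapT => inf; apply: xdom; exists (G F) => //; exact: imageP.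
Qed.

Theorem proposition23 : add fN_Fin #>= b_number.
Proof.
have nonempty : [set A : set (set (nat -> nat)) |
    A `<=` fN_Fin /\ ~ fN_Fin (\bigcup_(F in A) F)] !=set0.
  exists (range (@set1 (nat -> nat))).
  split=> [_ [x _ <-]|]; first exact: fN_Fin_set1.
  rewrite [X in fN_Fin X](_ : _ = setT); first exact: fN_Fin_proper.
  by apply/seteqP; split=> // x _; exists [set x] => //; exists x.
have [[AI AnI] _] := min_cardP nonempty.
have [G Gunb] := unbounded_image_of_fN_Fin_family AI AnI.
have [_ bmin] := min_cardP (ex_intro unbounded _ Gunb).
exact: card_le_trans (bmin _ Gunb) (card_image_le _ _).
Qed.
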